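(* Let $N,L\ge 1$ and let $C\in\{0,1\}^{NL\times NL}$ be a symmetric matrix with zero diagonal. Let $X,D\in\mathbb{R}^{N\times L}$. Let $S\in\{-1,1\}^{N\times L}$ be a sign pattern with $S_{j,l}=\operatorname{sign}(X_{j,l})$ whenever $X_{j,l}\neq 0$, and let $$\mathbb{R}_S^{N\times L}=\{Z\in\mathbb{R}^{N\times L} : S_{j,l}Z_{j,l}\ge 0 \text{ for all } j,l\}$$ be the corresponding (closed) orthant, so that $X\in\mathbb{R}_S^{N\times L}$. Then the function $$f\colon \{t\in\mathbb{R} : X+tD\in\mathbb{R}_S^{N\times L}\}\to\mathbb{R},\qquad f(t)=\mathcal{R}_C(|X+tD|)$$ is convex or concave. In particular, if $D\in\mathbb{R}_S^{N\times L}$ or $D\in-\mathbb{R}_S^{N\times L}$, then $f$ is convex.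
   Context: For $Z\in\mathbb{R}^{N\times L}$, $\operatorname{vec}(Z)\in\mathbb{R}^{NL}$ is its vectorization, and $|Z|$ is the matrix of entrywise absolute values. Rows and columns of $C$ are indexed by pairs $(j,l)\in\{1,\dots,N\}\times\{1,\dots,L\}$, consistently with the vectorization. The regularizer is $\mathcal{R}_C\colon\mathbb{R}^{N\times L}\to\mathbb{R}$, $\mathcal{R}_C(Z)=\operatorname{vec}(Z)^T C\operatorname{vec}(Z)$. *)

(* Defs.v *)
From mathcomp Require Import all_boot all_order all_algebra.
From mathcomp Require Import all_classical all_reals.
From mathcomp Require Import convex.

Set Implicit Arguments.
Unset Strict Implicit.
Unset Printing Implicit Defensive.

Import Order.TTheory GRing.Theory Num.Theory.

Local Open Scope classical_set_scope.
Local Open Scope ring_scope.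

(* [mxvec] is a row vector enumerating the pairs (j, l) in row-major order, so
   the index of C attached to (j, l) is [mxvec_index j l]. *)
Definition vec (R : realType) (N L : nat) (Z : 'M[R]_(N, L)) : 'cV[R]_(N * L) :=
  (mxvec Z)^T.

Definition regularizer (R : realType) (N L : nat) (C : 'M[R]_(N * L))
    (Z : 'M[R]_(N, L)) : R :=
  ((vec Z)^T *m C *m vec Z) 0 0.

Definition abs_mx (R : realType) (N L : nat) (Z : 'M[R]_(N, L)) :
    'M[R]_(N, L) :=
  map_mx Num.norm Z.

Definition orthant (R : realType) (N L : nat) (S : 'M[R]_(N, L)) :
    set 'M[R]_(N, L) :=
  [set Z | forall j l, 0 <= S j l * Z j l].

Definition line_in_orthant (R : realType) (N L : nat)
    (S X D : 'M[R]_(N, L)) : set R^o :=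
  [set t | orthant S (X + t *: D)].

(* Total in t; only its values on [line_in_orthant S X D] are meaningful here. *)
Definition line_regularizer (R : realType) (N L : nat) (C : 'M[R]_(N * L))
    (X D : 'M[R]_(N, L)) (t : R^o) : R^o :=
  regularizer C (abs_mx (X + t *: D)).

(* Like the library's [convex_function], this does not require the set A itself
   to be convex. *)
Definition concave_function (R : realType) (E : lmodType R)
    (A : set (convex_lmodType E)) (f : convex_lmodType E -> R^o) : Prop :=
  convex_function A (fun x => - f x).

(* Main.v *)
(** On the orthant of [S] the absolute value is the linear map [Z |-> S o Z]
    (entrywise product), so [f] agrees on its domain with a quadratic polynomial
    whose leading coefficient is [regularizer C (S o D)]; the sign of this
    coefficient decides between convexity and concavity. If [D] or [- D] lies in
    the orthant, then [S o D] has entries of constant sign and the leading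
    coefficient is nonnegative. *)
Require Import Defs.
From mathcomp Require Import all_boot all_order all_algebra.
From mathcomp Require Import all_classical all_reals.
From mathcomp Require Import convex.
From mathcomp Require Import interval_inference ring.

Set Implicit Arguments.
Unset Strict Implicit.

Import Order.TTheory GRing.Theory Num.Theory.

Local Open Scope classical_set_scope.
Local Open Scope ring_scope.

(** For a weight [p], the chord lies above the graph by exactly [p * (1 - p) * c * (x - y) ^+ 2].
    Convexity of [A] makes the formula for [f] available at the intermediate point. *)
Lemma convex_function_quadratic (R : realType) (A : set R^o) (f : R^o -> R^o)
    (a b c : R) :
  convex_set A -> (forall t, A t -> f t = a + t * b + t ^+ 2 * c) -> 0 <= c ->
  convex_function A f.
Proof.
move=> cvxA fE c_ge0 k x y Ax Ay.
have /set_mem Axy := cvxA x y k Ax Ay; move: Ax Ay => /set_mem Ax /set_mem Ay.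
rewrite !fE //.
have -> (u v : R^o) : conv k u v = k%:num * u + (1 - k%:num) * v by [].
have -> : conv k x y = k%:num * x + (1 - k%:num) * y by [].
have k_ge0 : 0 <= k%:num by [].
have k_le1 : k%:num <= 1 by [].
move: (k%:num) k_ge0 k_le1 => p p_ge0 p_le1.
rewrite -subr_ge0 [leRHS](_ : _ = p * (1 - p) * c * (x - y) ^+ 2); last by ring.
by rewrite mulr_ge0 ?sqr_ge0 // !mulr_ge0 // subr_ge0.
Qed.

Section Regularizer.
Variables (R : realType) (N L : nat) (C : 'M[R]_(N * L)).
Implicit Types A B Z : 'M[R]_(N, L).

Lemma regularizer_affine A B t :
  regularizer C (A + t *: B) = regularizer C A
    + t * (((vec A)^T *m C *m vec B) 0 0 + ((vec B)^T *m C *m vec A) 0 0)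
    + t ^+ 2 * regularizer C B.
Proof.
(* [linearP] wants the scaled summand first, hence the swaps by [addrC]. *)
have vecE : vec (A + t *: B) = vec A + t *: vec B.
  by rewrite /vec addrC !linearP addrC.
have vecTE : (vec (A + t *: B))^T = (vec A)^T + t *: (vec B)^T.
  by rewrite vecE addrC linearP addrC.
rewrite /regularizer vecTE vecE.
rewrite !(mulmxDl, mulmxDr) -!(scalemxAl, scalemxAr) scalerA.
(* Entries are taken through sums and scalings only: [mxE] itself would also unfold the matrix
   products, which [ring] should see as atoms. *)
have mxD (P Q : 'M[R]_1) : (P + Q) 0 0 = P 0 0 + Q 0 0 by rewrite mxE.
have mxZ r (P : 'M[R]_1) : (r *: P) 0 0 = r * P 0 0 by rewrite mxE.
by rewrite !(mxD, mxZ); ring.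
Qed.

Lemma regularizerN Z : regularizer C (- Z) = regularizer C Z.
Proof. by rewrite /regularizer /vec !linearN /= !mulNmx opprK. Qed.

Lemma regularizer_ge0 Z : (forall i k, 0 <= C i k) ->
  (forall j l, 0 <= Z j l) -> 0 <= regularizer C Z.
Proof.
move=> C_ge0 Z_ge0.
have v_ge0 i : 0 <= mxvec Z 0 i by case/mxvec_indexP: i => j l; rewrite mxvecE.
rewrite /regularizer /vec trmxK mxE sumr_ge0 // => i _; rewrite !mxE mulr_ge0 //.
by rewrite sumr_ge0 // => k _; rewrite mulr_ge0.
Qed.

End Regularizer.

Definition hadamard (R : realType) (N L : nat) (S Z : 'M[R]_(N, L)) :
    'M[R]_(N, L) :=
  map2_mx *%R S Z.

Section Orthant.
Variables (R : realType) (N L : nat) (S : 'M[R]_(N, L)).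
Implicit Types X D Z : 'M[R]_(N, L).

Lemma hadamard_affine X D t :
  hadamard S (X + t *: D) = hadamard S X + t *: hadamard S D.
Proof. by apply/matrixP=> j l; rewrite !mxE mulrDr mulrCA. Qed.

(** A nonnegative product equals its own absolute value, and the factor from [S] has absolute value
    1. *)
Lemma abs_mx_orthant Z : (forall j l, S j l = -1 \/ S j l = 1) ->
  orthant S Z -> abs_mx Z = hadamard S Z.
Proof.
move=> hS SZ; apply/matrixP=> j l; rewrite !mxE -(ger0_norm (SZ j l)) normrM.
by case: (hS j l) => ->; rewrite ?normrN1 ?normr1 mul1r.
Qed.

(** Each sign constraint is affine in [t], so its value at a convex combination is the same
    combination of the values at the endpoints. *)
Lemma convex_line_in_orthant X D : convex_set (line_in_orthant S X D).
Proof.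
move=> x y k /set_mem Sx /set_mem Sy; apply/mem_set => j l.
have := Sx j l; have := Sy j l; rewrite !mxE.
have -> : conv k x y = k%:num * x + (1 - k%:num) * y by [].
have k_ge0 : 0 <= k%:num by [].
have k_le1 : 0 <= 1 - k%:num by rewrite subr_ge0.
move: (k%:num) k_ge0 k_le1 => p p_ge0 p_le1 Sy_ge0 Sx_ge0.
rewrite [leRHS](_ : _ = p * (S j l * (X j l + x * D j l))
  + (1 - p) * (S j l * (X j l + y * D j l))); last by ring.
by rewrite addr_ge0 // mulr_ge0.
Qed.

Lemma regularizer_hadamard_ge0 (C : 'M[R]_(N * L)) D :
  (forall i k, 0 <= C i k) -> orthant S D \/ orthant S (- D) ->
  0 <= regularizer C (hadamard S D).
Proof.
(* When [- D] lies in the orthant, evenness of the quadratic form allows passing to the negated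
   product, whose entries are nonnegative. *)
move=> C_ge0 [SD|SD]; last rewrite -regularizerN;
  apply: regularizer_ge0 => // j l; have := SD j l; rewrite !mxE //.
by rewrite mulrN.
Qed.

End Orthant.

Unset Implicit Arguments.
Set Strict Implicit.

Theorem proposition6 (R : realType) (N L : nat)
    (hN : (1 <= N)%N) (hL : (1 <= L)%N)
    (C : 'M[R]_(N * L))
    (hC01 : forall i k, C i k = 0 \/ C i k = 1)
    (hCsym : C^T = C)
    (hCdiag : forall i, C i i = 0)
    (X D S : 'M[R]_(N, L))
    (hS : forall j l, S j l = -1 \/ S j l = 1)
    (hSX : forall j l, X j l != 0 -> S j l = Num.sg (X j l)) :
  [/\ orthant S X,
      convex_set (line_in_orthant S X D),
      convex_function (line_in_orthant S X D) (line_regularizer C X D) \/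
      concave_function (line_in_orthant S X D) (line_regularizer C X D)
    & orthant S D \/ orthant S (- D) ->
      convex_function (line_in_orthant S X D) (line_regularizer C X D)].
Proof.
have cvx := @convex_line_in_orthant R N L S X D.
set U := hadamard S X; set V := hadamard S D.
pose b := ((vec U)^T *m C *m vec V) 0 0 + ((vec V)^T *m C *m vec U) 0 0.
have fE t : line_in_orthant S X D t ->
    line_regularizer C X D t
    = regularizer C U + t * b + t ^+ 2 * regularizer C V.
  move=> St; rewrite /line_regularizer (abs_mx_orthant hS St).
  by rewrite hadamard_affine regularizer_affine.
have cvx_f : 0 <= regularizer C V ->
    convex_function (line_in_orthant S X D) (line_regularizer C X D).
  exact: convex_function_quadratic cvx fE.
split=> //.
- move=> j l; have [->|X_neq0] := eqVneq (X j l) 0; first by rewrite mulr0.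
  (* At a nonzero entry the product is [sg x * x], that is [|x|]. *)
  by rewrite hSX // -normrEsg.
- have [/cvx_f|c_lt0] := leP 0 (regularizer C V); first by left.
  (* Concavity is convexity of the negated function, a quadratic with all three coefficients
     negated. *)
  right; apply: (@convex_function_quadratic _ _ _ (- regularizer C U) (- b)
    (- regularizer C V) cvx) => [t /fE ->|]; last by rewrite oppr_ge0 ltW.
  by ring.
- move=> SD; apply/cvx_f/regularizer_hadamard_ge0 => // i k.
  by case: (hC01 i k) => ->.
Qed.
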